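(* There exist $C=C(X)>0$ and $M>0$ such that for every function $u:X\to\mathbb R$ (with $u_i=u(i)$) and all $l,l'\in\mathbb Z^d$ with $|l-l'|=1$, $$|\tilde u^l-\tilde u^{l'}|^2\le C\sum_{i,j\in[(Q^l_{T,d}\cup Q^{l'}_{T,d}+(-M,M)^d)\times Q_{T,k}]\cap X}|u_i-u_j|^2,$$ where $$\tilde u^l=\frac1{\#[(Q_{T,d}\times Q_{T,k})\cap X]}\sum_{i\in(Q^l_{T,d}\times Q_{T,k})\cap X}u_i.$$
   Context: Setting. Let $d,k\ge1$ and $T\in\mathbb N$, $T\ge1$. Put $Q_{T,d}=[0,T)^d$, $Q^l_{T,d}=lT+[0,T)^d$ for $l\in\mathbb Z^d$, and $Q_{T,k}=[0,T)^k$. $X\subset\mathbb Z^d\times\{0,\dots,T-1\}^k$ is a fixed nonempty set and $\mathcal E\subset X\times X$ is a set of edges such that: (i) $X$ is $T$-periodic in $e_1,\dots,e_d$ ($X+Te_m=X$ for $m=1,\dots,d$); (ii) for all $i,j\in X$ there is a finite sequence $i_0=i,i_1,\dots,i_N=j$ in $X$ with $(i_n,i_{n+1})\in\mathcal E$ for every $n$, and $\mathcal E$ is $T$-periodic, i.e. invariant under $(i,j)\mapsto(i+Te_m,j+Te_m)$, $m=1,\dots,d$; (iii) there is $R>0$ with $|i-j|\le R$ for all $(i,j)\in\mathcal E$. For sets $A,B$, $A+B$ is the Minkowski sum, and $Q^l_{T,d}\cup Q^{l'}_{T,d}+(-M,M)^d$ means $(Q^l_{T,d}\cup Q^{l'}_{T,d})+(-M,M)^d$.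 *)

(* Defs.v *)
From mathcomp Require Import all_boot all_order all_algebra finmap.
From mathcomp Require Import all_classical all_reals.

Set Implicit Arguments.
Unset Strict Implicit.
Unset Printing Implicit Defensive.

Import Order.TTheory GRing.Theory Num.Theory.
Local Open Scope classical_set_scope.
Local Open Scope ring_scope.

(* Z^d * Z^k; the k bounded directions are cut down to {0, ..., T-1} by
   [in_slab]. *)
Notation node d k := ('rV[int]_d * 'rV[int]_k)%type.

Definition in_slab (d k T : nat) (X : set (node d k)) : Prop :=
  X `<=` [set i : node d k | forall b, i.2 0 b \in `[0, T%:Z[].

(* T e_m, for m among the d periodic directions *)
Definition shift (d k T : nat) (m : 'I_d) : node d k :=
  (delta_mx 0 m *+ T, 0).

Definition periodic_set (d k T : nat) (X : set (node d k)) : Prop :=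
  forall m : 'I_d, [set i + shift k T m | i in X] = X.

Definition periodic_edges (d k T : nat) (E : set (node d k * node d k)) :
    Prop :=
  forall m : 'I_d,
    [set (e.1 + shift k T m, e.2 + shift k T m) | e in E] = E.

(* Edges are directed: symmetry of E is not assumed. *)
Definition connected_by (d k : nat) (X : set (node d k))
    (E : set (node d k * node d k)) : Prop :=
  forall i j, X i -> X j ->
    exists (N : nat) (p : nat -> node d k),
      [/\ p 0%N = i, p N = j,
          (forall n, (n <= N)%N -> X (p n)) &
          (forall n, (n < N)%N -> E (p n, p n.+1))].

(* The library's norm on 'rV is the sup norm, hence this Euclidean one. *)
Definition enorm (R : realType) (n : nat) (v : 'rV[R]_n) : R :=
  Num.sqrt (\sum_(a < n) v 0 a ^+ 2).

Definition toR (R : realType) (n : nat) (v : 'rV[int]_n) : 'rV[R]_n :=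
  map_mx intr v.
Arguments toR R {n} v.

Definition finite_range (R : realType) (d k : nat)
    (E : set (node d k * node d k)) : Prop :=
  exists2 r : R, 0 < r &
    forall i j, E (i, j) ->
      enorm (toR R (row_mx (i - j).1 (i - j).2)) <= r.

Definition minkowski (R : realType) (n : nat) (A B : set 'rV[R]_n) :
    set 'rV[R]_n :=
  [set x + y | x in A & y in B].

(* [0, T)^n *)
Definition cube (R : realType) (n T : nat) : set 'rV[R]_n :=
  [set x : 'rV[R]_n | forall a, x 0 a \in `[0, T%:R[].
Arguments cube : clear implicits.

(* (-M, M)^n *)
Definition open_cube (R : realType) (n : nat) (M : R) : set 'rV[R]_n :=
  [set x : 'rV[R]_n | forall a, x 0 a \in `]- M, M[].
Arguments open_cube {R} n M.

(* Q^l_{T,d} = l T + [0, T)^d *)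
Definition cell (R : realType) (d T : nat) (l : 'rV[int]_d) : set 'rV[R]_d :=
  [set T%:R *: toR R l + x | x in cube R d T].
Arguments cell R {d} T l.

(* (A * Q_{T,k}) /\ X, as a set of elements of the subtype X *)
Definition nodes_over (R : realType) (d k T : nat) (X : set (node d k))
    (A : set 'rV[R]_d) : set X :=
  [set i : X | (A `*` cube R k T) (toR R (val i).1, toR R (val i).2)].
Arguments nodes_over {R d k} T X A.

(* [\sum_(i \in A)] is the finitely supported sum; the sets summed over are
   finite whenever A is bounded. *)
Definition cell_mean (R : realType) (d k T : nat) (X : set (node d k))
    (u : X -> R) (l : 'rV[int]_d) : R :=
  (#|` fset_set (nodes_over T X (cube R d T))|%fset%:R)^-1 *
  \sum_(i \in nodes_over T X (cell R T l)) u i.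

(* Main.v *)
Require Import Defs.
From mathcomp Require Import all_boot all_order all_algebra finmap.
From mathcomp Require Import all_classical all_reals.
From mathcomp Require Import zify.

Set Implicit Arguments.
Unset Strict Implicit.
Unset Printing Implicit Defensive.

Import Order.TTheory GRing.Theory Num.Theory.
Local Open Scope classical_set_scope.
Local Open Scope ring_scope.

(** Translation by [T (l' - l)] maps the nodes of the cell at [l] bijectively
    onto those of the cell at [l'], because [X] is periodic.  Hence the
    difference of the two means is the average, over the nodes [i] of the cell
    at the origin, of the differences [u (i + T l) - u (i + T l')].  An average
    is at most the largest of its terms in absolute value, and the square of
    each of these terms is one of the nonnegative terms of the right-hand side,
    whose double sum runs over all pairs of nodes of the neighbourhood of the
    two cells.  The inequality therefore holds with [C = 1] and [M = 1].

    The right-hand side is a finitely supported sum, which is [0] by convention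
    when the support is infinite; so the argument also needs that only finitely
    many nodes lie over a bounded set ([finite_nodes_over]). *)

Lemma lattice_shiftNK (d k T : nat) (l : 'rV[int]_d) :
  ((- l) *+ T, 0) + (l *+ T, 0) = 0 :> node d k.
Proof. by rewrite mulNrn; congr (_, _); rewrite ?addNr ?addr0. Qed.

(** The vectors [v] for which translation by [T v] preserves [X] form a group,
    which contains the canonical basis by periodicity. *)
Lemma mem_lattice_shift (d k T : nat) (X : set (node d k))
    (X_per : periodic_set T X) (l : 'rV[int]_d) (i : node d k) :
  X (i + (l *+ T, 0)) <-> X i.
Proof.
pose inv v := forall j, X (j + (v *+ T, 0)) <-> X j.
have inv_gen m : inv (delta_mx 0 m).
  move=> j; split=> [|Xj]; last by rewrite -(X_per m); exists j.
  by rewrite -{1}(X_per m) => -[j' Xj' /addIr <-].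
have inv0 : inv 0 by move=> j; rewrite mul0rn addr0.
have invD v w : inv v -> inv w -> inv (v + w).
  move=> iv iw j; rewrite mulrnDl.
  have -> : j + (v *+ T + w *+ T, 0) = j + (v *+ T, 0) + (w *+ T, 0).
    by rewrite -addrA; congr (_ + (_, _)); rewrite addr0.
  by split=> [/iw/iv|Xj] //; apply/iw/iv.
have invN v : inv v -> inv (- v).
  by move=> iv j; rewrite -(iv (j + _)) -addrA lattice_shiftNK addr0.
suff : inv l by apply.
rewrite (row_sum_delta l); apply: big_ind => // m _.
have -> : l 0 m *: delta_mx 0 m = delta_mx 0 m *~ l 0 m :> 'rV[int]_d.
  by rewrite -scaler_int intz.
elim/int_ind: (l 0 m) => [|n IHn|n IHn]; rewrite ?mulr0z //.
  by rewrite intS mulrzDr mulr1z; apply: invD.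
by rewrite intS opprD mulrzDr mulrN1z; apply: invD => //; apply: invN.
Qed.

Definition translate (d k T : nat) (X : set (node d k))
    (X_per : periodic_set T X) (l : 'rV[int]_d) (i : X) : X :=
  SigSub (mem_set ((mem_lattice_shift X_per l (val i)).2 (set_valP i))).

Lemma translate_bij (R : realType) (d k T : nat) (X : set (node d k))
    (X_per : periodic_set T X) (l : 'rV[int]_d) :
  set_bij (nodes_over T X (cube R d T)) (nodes_over T X (cell R T l))
    (translate X_per l).
Proof.
have toRl (v : 'rV[int]_d) :
    toR R (v + l *+ T) = T%:R *: toR R l + toR R v.
  by apply/rowP => a; rewrite !mxE mulmxnE rmorphD rmorphMn /= mulr_natl addrC.
have val_translate (i : X) : val (translate X_per l i) = val i + (l *+ T, 0).
  by [].
split.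
- move=> i [/= Qi1 Qi2]; split=> /=; last by rewrite addr0.
  by rewrite toRl; exists (toR R (val i).1).
- move=> i j _ _ /(congr1 val); rewrite !val_translate.
  by move=> /addIr/val_inj.
- move=> j [/= [x Qx xj] Qj2].
  have Xj : X (val j + ((- l) *+ T, 0)).
    by apply/(mem_lattice_shift X_per); exact: set_valP.
  exists (SigSub (mem_set Xj)).
    split=> /=; last by rewrite addr0.
    suff -> : toR R ((val j).1 + (- l) *+ T) = x by [].
    apply: (addrI (T%:R *: toR R l)); rewrite -toRl xj.
    by rewrite mulNrn addrNK.
  apply/val_inj; rewrite val_translate /= -addrA.
  by rewrite lattice_shiftNK addr0.
Qed.

(** Bounded integer coordinates are encoded in a finite type; the shift by [B]
    makes the periodic coordinates nonnegative, so that [absz] loses nothing. *)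
Lemma finite_nodes_over (R : realType) (d k T : nat) (X : set (node d k))
    (A : set 'rV[R]_d) (B : nat)
    (A_bounded : forall x, A x -> forall a, `|x 0 a| <= B%:R) :
  finite_set (nodes_over T X A).
Proof.
pose f (i : X) : 'rV['I_(B + B).+1]_d * 'rV['I_T.+1]_k :=
  (\row_a inord (absz ((val i).1 0 a + B%:Z)),
   \row_b inord (absz ((val i).2 0 b))).
have f_inj : {in nodes_over T X A &, injective f}.
  have bounded_abs (z : int) (n : nat) : `|z%:~R| <= n%:R :> R -> (`|z| <= n)%N.
    by rewrite -intr_norm -abszE -pmulrn ler_nat.
  move=> i j /set_mem[/= Ai Qi] /set_mem[/= Aj Qj] [/rowP f1 /rowP f2].
  apply/val_inj; rewrite [LHS]surjective_pairing [RHS]surjective_pairing.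
  congr (_, _); apply/rowP => a /=.
    have {}f1 := congr1 (@nat_of_ord _) (f1 a); rewrite !mxE in f1.
    have := A_bounded _ Ai a; have := A_bounded _ Aj a; rewrite !mxE.
    move=> /bounded_abs jB /bounded_abs iB.
    by rewrite !inordK in f1; lia.
  have {}f2 := congr1 (@nat_of_ord _) (f2 a); rewrite !mxE in f2.
  have := Qi a; have := Qj a; rewrite !in_itv /= !mxE !pmulrn !ler0z !ltr_int.
  by move=> /andP[j0 jT] /andP[i0 iT]; rewrite !inordK in f2; lia.
rewrite -(eq_finite_set (inj_card_eq f_inj)).
exact: finite_finset.
Qed.

Lemma norm_mean_le (R : realFieldType) (I : choiceType) (S : set I) (f : I -> R)
    (b : R) :
  finite_set S -> 0 <= b -> (forall i, S i -> `|f i| <= b) ->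
  `|(#|` fset_set S|%fset%:R)^-1 * \sum_(i \in S) f i| <= b.
Proof.
move=> finS b_ge0 fb; rewrite fsbig_finite //= normrM normfV normr_nat.
set N := (#|` _|)%fset.
(* The average over an empty set is 0, since the inverse of 0 is 0. *)
have [->|N0] := eqVneq N 0%N; first by rewrite invr0 mul0r.
rewrite ler_pdivrMl ?ltr0n ?lt0n //.
apply: le_trans (ler_norm_sum _ _ _) _.
have -> : N%:R * b = \sum_(i <- fset_set S) b.
  by rewrite big_const_seq count_predT iter_addr_0 mulr_natl.
rewrite big_seq [leRHS]big_seq; apply: ler_sum => i.
by rewrite in_fset_set // inE => /fb.
Qed.

Lemma fsumr_ge_term (R : numDomainType) (I : choiceType) (S : set I) (f : I -> R)
    (i : I) :
  finite_set S -> (forall j, 0 <= f j) -> S i -> f i <= \sum_(j \in S) f j.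
Proof.
move=> finS f0 Si; rewrite (fsbigD1 i) //= lerDl.
by apply: fsumr_ge0.
Qed.

Lemma finite_nodes_over_cube (R : realType) (d k T : nat) (X : set (node d k)) :
  finite_set (nodes_over T X (cube R d T)).
Proof.
apply: (@finite_nodes_over _ _ _ _ _ _ T) => x Qx a.
by have := Qx a; rewrite in_itv /= => /andP[x0 /ltW]; rewrite ger0_norm.
Qed.

Lemma finite_nodes_over_cells (R : realType) (d k T : nat)
    (X : set (node d k)) (l l' : 'rV[int]_d) :
  finite_set (nodes_over T X
    (minkowski (cell R T l `|` cell R T l') (open_cube d 1))).
Proof.
pose B := (T * (\sum_a (`|l 0%R a| + `|l' 0%R a|)%N) + T + 1)%N.
have cellB (v : 'rV[int]_d) x a :
    (forall a, `|v 0%R a| <= `|l 0%R a| + `|l' 0%R a|)%N ->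
    cell R T v x -> `|x 0 a| <= B%:R - 1.
  move=> vB [y Qy <-]; rewrite !mxE /B natrD addrK natrD natrM.
  apply: le_trans (ler_normD _ _) _; apply: lerD.
    rewrite normrM normr_nat ler_wpM2l // -intr_norm -abszE -pmulrn ler_nat.
    by apply: leq_trans (vB a) _; rewrite (bigD1 a) //= leq_addr.
  by have := Qy a; rewrite in_itv /= => /andP[y0 /ltW]; rewrite ger0_norm.
apply: (@finite_nodes_over _ _ _ _ _ _ B) => _ [x Ux [y My <-]] a.
rewrite mxE -[B%:R](subrK 1); apply: le_trans (ler_normD _ _) _.
apply: lerD; last by have := My a; rewrite in_itv /= -ltr_norml => /ltW.
by case: Ux; apply: cellB => b; rewrite ?leq_addr ?leq_addl.
Qed.

(** Both means become averages over the single cell at the origin, so that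
    their difference is the average of the differences of [u] at nodes that
    correspond to each other under a translation. *)
Lemma cell_mean_translate (R : realType) (d k T : nat) (X : set (node d k))
    (X_per : periodic_set T X) (u : X -> R) (l : 'rV[int]_d) :
  let S := nodes_over T X (cube R d T) in
  cell_mean T u l =
    (#|` fset_set S|%fset%:R)^-1 * \sum_(i \in S) u (translate X_per l i).
Proof.
by rewrite /= /cell_mean (reindex_fsbig _ _ _ _ (translate_bij R X_per l)).
Qed.

Theorem proposition3p1 (R : realType) (d k T : nat)
    (d_gt0 : (0 < d)%N) (k_gt0 : (0 < k)%N) (T_gt0 : (0 < T)%N)
    (X : set (node d k)) (X_neq0 : X !=set0) (X_slab : in_slab T X)
    (X_per : periodic_set T X) :
  exists2 C : R, 0 < C &
    forall E : set (node d k * node d k),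
      E `<=` X `*` X -> connected_by X E -> periodic_edges T E ->
      finite_range R E ->
    exists2 M : R, 0 < M &
      forall (u : X -> R) (l l' : 'rV[int]_d),
        enorm (toR R (l - l')) = 1 ->
        let D := nodes_over T X
          (minkowski (cell R T l `|` cell R T l') (open_cube d M)) in
        `|cell_mean T u l - cell_mean T u l'| ^+ 2
          <= C * \sum_(p \in D `*` D) `|u p.1 - u p.2| ^+ 2.
Proof.
exists 1 => // E _ _ _ _; exists 1 => // u l l' _.
cbv zeta; set D := nodes_over _ _ _; rewrite mul1r.
set W := \sum_(_ \in _) _; set S := nodes_over T X (cube R d T).
have W_ge0 : 0 <= W by apply: fsumr_ge0 => p _; exact: exprn_ge0.
have finS : finite_set S by exact: finite_nodes_over_cube.
have translateD v i : cell R T v `<=` cell R T l `|` cell R T l' -> S i ->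
    D (translate X_per v i).
  move=> vU Si; have [vi1 vi2] := set_bij_homo (translate_bij R X_per v) Si.
  split=> //; exists (toR R (val (translate X_per v i)).1); first exact: vU.
  exists 0; last by rewrite addr0.
  by move=> a; rewrite mxE in_itv /= ltrN10 ltr01.
rewrite !(cell_mean_translate X_per) -mulrBr -[W]sqr_sqrtr //.
apply: lerXn2r; rewrite ?nnegrE ?sqrtr_ge0 //.
rewrite !fsbig_finite //= -sumrB -[X in _ * X]fsbig_finite //.
apply: norm_mean_le => [||i Si]; rewrite ?sqrtr_ge0 //.
rewrite -sqrtr_sqr ler_sqrt // -(real_normK (num_real _)).
(* This square is the term of W at the pair of translates of i. *)
pose q := (translate X_per l i, translate X_per l' i).
rewrite -[leLHS]/((fun p : X * X => `|u p.1 - u p.2| ^+ 2) q).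
apply: fsumr_ge_term => [|j|]; last 1 first.
- by split; apply: translateD.
- by apply: finite_setX; exact: finite_nodes_over_cells.
- exact: exprn_ge0.
Qed.
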